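(* For every integer $d \geq 1$, $L^\circ_{d+2} \geq L^\circ_d\,(2L^\circ_d+1)$.
   Context: For $a,b \in \mathbb{N}$ write $a \rightarrow b$ iff either $b = a+1$ or $b = 0$. For vectors $v,w \in \mathbb{N}^d$ write $v \rightarrow w$ iff $v^\ell \rightarrow w^\ell$ for every coordinate $\ell$, and $v \leq w$ iff $v^\ell \leq w^\ell$ for every coordinate $\ell$. A sequence $(v_0,\ldots,v_{n-1})$ of vectors in $\mathbb{N}^d$ is valid iff $v_i \rightarrow v_{i+1}$ for each $i < n-1$; it is cyclic iff it is valid and additionally $v_{n-1} \rightarrow v_0$. A sequence is non-dominating iff $v_i \not\leq v_j$ whenever $i < j$. $L^\circ_d$ denotes the maximum length of a non-dominating cyclic sequence of vectors in $\mathbb{N}^d$. *)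

(* Defs.v *)
From mathcomp Require Import all_boot.
From mathcomp Require Import boolp.
From mathcomp Require Import zify.

Set Implicit Arguments.
Unset Strict Implicit.
Unset Printing Implicit Defensive.

Definition vec (d : nat) := {ffun 'I_d -> nat}.

Definition nstep (a b : nat) : bool := (b == a.+1) || (b == 0).

Definition vstep d : rel (vec d) :=
  fun v w => [forall l, nstep (v l) (w l)].

Definition vle d : rel (vec d) := fun v w => [forall l, v l <= w l].

Definition valid d (s : seq (vec d)) : bool := sorted (@vstep d) s.

Definition cyclic d (s : seq (vec d)) : bool := cycle (@vstep d) s.

Definition non_dominating d (s : seq (vec d)) : bool :=
  pairwise (fun v w => ~~ vle v w) s.

Lemma cyclicE d (v : vec d) (s : seq (vec d)) :
  cyclic (v :: s) = valid (v :: s) && vstep (last v s) v.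
Proof. by rewrite /cyclic /valid /= rcons_path. Qed.

Definition is_ndc_length d (n : nat) : Prop :=
  exists s : seq (vec d), [/\ size s = n, cyclic s & non_dominating s].

(* The maximum length exists: Dickson's lemma together with a compactness
   argument bounds the length of every valid non-dominating sequence. *)

Lemma monotone_subseq (u : nat -> nat) :
  exists g : nat -> nat, {homo g : i j / i < j} /\ {homo (u \o g) : i j / i <= j}.
Proof.
have minP m : {k | m <= k /\ forall j, m <= j -> u k <= u j}.
  apply: cid; suff H : forall b i, m <= i -> u i <= b ->
    exists k, m <= k /\ forall j, m <= j -> u k <= u j by exact: (H (u m) m).
  elim=> [|b IH] i mi ub; first by exists i; split=> // j _; lia.
  have [[j [mj uj]]|nex] := pselect (exists j, m <= j /\ u j <= b).
    exact: IH mj uj.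
  exists i; split=> // j mj; case: (leqP (u i) (u j)) => // lt.
  by case: nex; exists j; split=> //; lia.
pose g := fix g n := if n is n'.+1 then sval (minP (g n').+1) else sval (minP 0).
have gmin n j : g n <= j -> u (g n) <= u j.
  case: n => [|n] /=; case: (minP _) => k [/= mk h] kj; apply: h; lia.
have glt n : g n < g n.+1 by rewrite /=; case: (minP _) => k [].
exists g; split; first exact: (homo_ltn ltn_trans glt).
apply: homo_leq => // [x y z|n]; first exact: leq_trans.
exact/gmin/ltnW/glt.
Qed.

Lemma dickson (I : finType) (f : nat -> I -> nat) :
  exists i j, i < j /\ forall k, f i k <= f j k.
Proof.
suff [g [gh fh]] : exists g : nat -> nat, {homo g : i j / i < j} /\
    forall k, k \in enum I -> {homo (fun n => f (g n) k) : i j / i <= j}.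
  exists (g 0), (g 1); split=> [|k]; first by apply: gh.
  by apply: (fh k _ 0 1) => //; rewrite mem_enum.
elim: (enum I) => [|k s [g [gh fh]]]; first by exists (fun n => n); split.
have [h [hh uh]] := monotone_subseq (fun n => f (g n) k).
have hle : {homo h : i j / i <= j}.
  by move=> i j; rewrite leq_eqVlt => /orP[/eqP->//|/hh/ltnW].
exists (g \o h); split=> [i j /hh/gh //|k']; rewrite inE => /orP[/eqP-> //|ks].
by move=> i j ij; apply: (fh k' ks (h i) (h j)); exact: hle.
Qed.

Lemma controlled_bad_bound (I : finType) :
  exists N, forall n (a : nat -> {ffun I -> nat}),
    (forall i k, i < n -> a i k <= i.+1) ->
    (forall i j, i < j < n -> exists k, a j k < a i k) -> n <= N.
Proof.
apply: contrapT => nN.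
pose bad n (a : nat -> {ffun I -> nat}) :=
  (forall i k, i < n -> a i k <= i.+1) /\
  (forall i j, i < j < n -> exists k, a j k < a i k).
pose P p := forall N, exists n a, [/\ N < n, bad n a & mkseq a (size p) = p].
have P0 : P [::].
  move=> N; apply: contrapT => H; apply: nN; exists N => n a a1 a2.
  by rewrite leqNgt; apply/negP => lt; apply: H; exists n, a.
have PS p : P p -> exists v, P (rcons p v).
  move=> Pp; apply: contrapT => H.
  have H1 v : exists N, forall n a, N < n -> bad n a ->
      mkseq a (size p) = p -> a (size p) <> v.
    apply: contrapT => H1; apply: H; exists v => N; apply: contrapT => H2.
    apply: H1; exists N => n a lt b e av; apply: H2; exists n, a; split=> //.
    by rewrite size_rcons /mkseq -addn1 iotaD map_cat cats1 -/(mkseq _ _) e add0n av.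
  have [Nf NfP] := choice H1.
  pose emb (w : {ffun I -> 'I_(size p).+2}) : {ffun I -> nat} := [ffun k => w k : nat].
  have [n [a [lt b e]]] := Pp (maxn (size p) (\max_w Nf (emb w))).
  pose w : {ffun I -> 'I_(size p).+2} := [ffun k => inord (a (size p) k)].
  have ew : emb w = a (size p).
    apply/ffunP => k; rewrite !ffunE inordK //; apply: b.1; lia.
  apply: (NfP (emb w) n a) => //.
  by have := leq_bigmax (F := fun w => Nf (emb w)) w; lia.
have [nx nxP] : exists nx, forall p, P p -> P (rcons p (nx p)).
  have /choice[nx h] p : exists v, P p -> P (rcons p v).
    case: (pselect (P p)) => [/PS[v]|np]; first by exists v.
    by exists [ffun=> 0] => /np.
  by exists nx.
pose q := fix q n := if n is n'.+1 then rcons (q n') (nx (q n')) else [::].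
have Pq n : P (q n) by elim: n => //= n; exact: nxP.
have sq n : size (q n) = n by elim: n => //= n; rewrite size_rcons => ->.
pose f n := nx (q n).
have fq n : q n = mkseq f n.
  by elim: n => //= n IH; rewrite /mkseq -addn1 iotaD map_cat cats1 -/(mkseq _ _) -IH add0n.
have [i [j [ij le]]] := dickson (fun n k => f n k).
have [n [a [lt b]]] := Pq j.+1 j.+1.
rewrite fq size_mkseq => e.
have ea m : m <= j -> a m = f m.
  move=> mj; have := congr1 (fun s => nth (f 0) s m) e.
  by rewrite !nth_mkseq.
have [k] := b.2 i j ltac:(lia).
by rewrite !ea ?(ltnW ij) // ltnNge le.
Qed.

Lemma valid_non_dominating_bounded d :
  exists N, forall s : seq (vec d), valid s -> non_dominating s -> size s <= N.
Proof.
have [N NP] := controlled_bad_bound ('I_d * bool)%type.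
exists N => s vs nd; pose v0 : vec d := [ffun=> 0].
pose v i l := nth v0 s i l.
have vS i l : i.+1 < size s -> v i.+1 l = (v i l).+1 \/ v i.+1 l = 0.
  move=> lt; move/sortedP : vs => /(_ v0 i lt)/forallP/(_ l).
  by case/orP => /eqP; [left | right].
have vD i m l : i + m < size s -> v (i + m) l <= v i l + m.
  elim: m => [|m IH]; first by rewrite !addn0.
  by rewrite !addnS => lt; have := IH (ltnW lt); case: (vS _ l lt); lia.
have vC i l : i < size s -> v i l = v 0 l + i \/ v i l < i.
  elim: i => [|i IH] lt; first by left; rewrite addn0.
  by have := IH (ltnW lt); case: (vS _ l lt); lia.
(* A coordinate never reset so far is recorded by a flag instead of its
   (unbounded) value, which makes the initial vector irrelevant. *)
pose a i : {ffun 'I_d * bool -> nat} := [ffun k =>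
  let pre := v i k.1 == v 0 k.1 + i in
  if k.2 then nat_of_bool pre else if pre then 0 else v i k.1].
apply: (NP _ a) => [i [l b] lt|i j /andP[ij jn]].
  by rewrite ffunE /=; case: b; case: eqP => //; case: (vC i l lt); lia.
apply: contrapT => H.
have le k : a i k <= a j k.
  by rewrite leqNgt; apply/negP => lt; apply: H; exists k.
move/pairwiseP : nd => /(_ v0) /(_ i j); rewrite !inE => /(_ (ltn_trans ij jn) jn ij).
case/negP; apply/forallP => l.
have := le (l, true); have := le (l, false); rewrite !ffunE /= -!/(v _ _).
have := vD i (j - i) l; rewrite subnKC ?(ltnW ij)// => /(_ jn).
have := vD 0 i l (ltn_trans ij jn); rewrite add0n.
by case: eqP; case: eqP => /=; lia.
Qed.

Lemma ndc_length_bounded d :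
  exists N, forall n, `[< is_ndc_length d n >] -> n <= N.
Proof.
have [N NP] := valid_non_dominating_bounded d.
exists N => n /asboolP[[|v s] [<- cs nds]] //; apply: NP => //.
by move: cs; rewrite cyclicE => /andP[].
Qed.

Lemma ndc_length_ex d : exists n, `[< is_ndc_length d n >].
Proof. by exists 0; apply/asboolP; exists [::]. Qed.

Definition Lcirc (d : nat) : nat :=
  ex_maxn (ndc_length_ex d) (svalP (cid (ndc_length_bounded d))).

Lemma LcircP d :
  is_ndc_length d (Lcirc d) /\ (forall n, is_ndc_length d n -> n <= Lcirc d).
Proof.
rewrite /Lcirc; case: ex_maxnP => m /asboolP Pm max; split=> // n Pn.
exact/max/asboolP.
Qed.

(* Main.v *)
Require Import Defs.
From mathcomp Require Import all_boot.
From mathcomp Require Import zify.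

(** Let [v] be a longest cyclic non-dominating sequence, of length [L], and run
    through it [2L+1] times with two extra coordinates, which take turns being
    the active one: the active coordinate of round [r] is reset at the start of
    the round and once more at position [k = r./2], so that it enters the next
    round with value [L - k]; the passive one is not reset.  Only pairs made of
    position [p] in round [r] and position [q <= p] in a later round [s] need
    attention, and for these the coordinate passive in round [r] decreases: if
    [s] has the parity of [r] because [k] is larger for later rounds, and
    otherwise because its value is at most [q] in round [s] but larger than [p]
    in round [r]. *)

Set Implicit Arguments.
Unset Strict Implicit.
Unset Printing Implicit Defensive.

Lemma cyclic_nth d (v0 : vec d) s i : cyclic s -> i < size s ->
  vstep (nth v0 s i) (nth v0 s (i.+1 %% size s)).
Proof.
case: s => // v s; rewrite cyclicE => /andP[/sortedP h hl] lt.
have [lt'|ge] := ltnP i.+1 (size (v :: s)); first by rewrite modn_small ?h.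
have -> : i = size s by move: lt ge => /=; lia.
by rewrite modnn nth_last.
Qed.

Lemma cyclic_mkseq d (w : nat -> vec d) n :
  (forall t, t < n -> vstep (w t) (w t.+1)) -> vstep (w n) (w 0) ->
  cyclic (mkseq w n.+1).
Proof.
move=> h hl; have e : mkseq w n.+1 = w 0 :: mkseq (w \o S) n.
  by rewrite /mkseq /= -[in iota 1 n](addn0 1) iotaDl -map_comp.
rewrite e cyclicE -e; apply/andP; split.
  apply/(sortedP (w 0)) => i; rewrite size_mkseq => lt.
  by rewrite !nth_mkseq ?h // ltnW.
by rewrite (last_nth (w 0)) size_mkseq -e nth_mkseq.
Qed.

Lemma non_dominating_mkseq d (w : nat -> vec d) n :
  (forall i j, i < j < n -> ~~ vle (w i) (w j)) ->
  non_dominating (mkseq w n).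
Proof.
move=> h; apply/(pairwiseP (w 0)) => i j; rewrite !inE size_mkseq => li lj lt.
by rewrite !nth_mkseq ?h ?lt.
Qed.

(* The coordinate active in the rounds of parity [b], at position [p] of round
   [r].  The passive value at the start of round [r > 0] is [L - r.-1./2], left
   by round [r.-1]; at [r = 0] it is [L.+1], which continues round [2L]. *)
Definition clock (L : nat) (b : bool) (r p : nat) : nat :=
  if odd r == b then (if p < r./2 then p else p - r./2)
  else L.+1 - uphalf r + p.

Lemma clock_step L b r p : nstep (clock L b r p) (clock L b r p.+1).
Proof.
by apply/orP; rewrite /clock; case: ifP => _; do ?case: ifP; lia.
Qed.

(** As [r./2 < L], the active coordinate ends at [L.-1 - r./2] and goes on rising as the passive
    one; the other is reset. *)
Lemma clock_next_round L b r : r < 2 * L ->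
  nstep (clock L b r L.-1) (clock L b r.+1 0).
Proof.
move=> rL; apply/orP; rewrite /clock oddS !uphalf_half; have := odd_double_half r.
by case: (odd r); case: b => /=; do ?case: ifP; lia.
Qed.

(** Rounds [2 * L] and [0] are both even, so the roles do not swap here: the active coordinate is
    simply reset. *)
Lemma clock_wrap L b : 0 < L ->
  nstep (clock L b (2 * L) L.-1) (clock L b 0 0).
Proof.
move=> L0; apply/orP; rewrite /clock mul2n odd_double uphalf_double doubleK.
by case: b => /=; do ?case: ifP; lia.
Qed.

Lemma clock_decr L r s p q : r < s <= 2 * L -> q <= p ->
  clock L (~~ odd r) s q < clock L (~~ odd r) r p.
Proof.
rewrite /clock !uphalf_half; have := odd_double_half r; have := odd_double_half s.
by case: (odd r); case: (odd s) => /=; do ?case: ifP; lia.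
Qed.

Definition extend d (v : vec d) (x : bool -> nat) : vec (d + 2) :=
  [ffun l => match split l with inl a => v a | inr c => x (c != ord0) end].

Lemma vstep_extend d (v v' : vec d) x x' : vstep v v' ->
  (forall b, nstep (x b) (x' b)) -> vstep (extend v x) (extend v' x').
Proof.
by move=> /forallP hv hx; apply/forallP => l; rewrite !ffunE; case: split.
Qed.

Lemma vle_extendl d (v v' : vec d) x x' :
  vle (extend v x) (extend v' x') -> vle v v'.
Proof.
move=> /forallP h; apply/forallP => l; have := h (lshift 2 l).
by rewrite !ffunE (unsplitK (inl _ l)).
Qed.

Lemma vle_extendr d (v v' : vec d) x x' b :
  vle (extend v x) (extend v' x') -> x b <= x' b.
Proof.
move=> /forallP h; pose c : 'I_2 := if b then ord_max else ord0.
have := h (rshift d c); rewrite !ffunE (unsplitK (inr _ c)) {}/c.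
by case: b.
Qed.

Lemma ndc_length_extend d L : is_ndc_length d L ->
  is_ndc_length (d + 2) (L * (2 * L + 1)).
Proof.
case: (posnP L) => [->|L0 [s [sL cs nds]]]; first by exists [::].
pose v0 : vec d := [ffun=> 0].
pose w t := extend (nth v0 s (t %% L)) (fun b => clock L b (t %/ L) (t %% L)).
have modL t : t %% L < L by rewrite ltn_mod.
have nextP t : (t.+1 %/ L = t %/ L /\ t.+1 %% L = (t %% L).+1) \/
    [/\ t.+1 %/ L = (t %/ L).+1, t.+1 %% L = 0 & t %% L = L.-1].
  have [lt|ge] := ltnP (t %% L).+1 L; [left|right]; have dm := divn_eq t L.
    rewrite {1 3}dm -addnS divnMDl // modnMDl.
    by rewrite (divn_small lt) (modn_small lt) addn0.
  have pL : t %% L = L.-1 by have := modL t; lia.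
  rewrite {1 3}dm -addnS pL prednK // divnMDl // modnMDl divnn modnn L0.
  by rewrite addn1.
have vstepv t : vstep (nth v0 s (t %% L)) (nth v0 s (t.+1 %% L)).
  by have := cyclic_nth v0 cs (i := t %% L); rewrite sL => /(_ (modL t)); rewrite -addn1 modnDml addn1.
pose n := (L * (2 * L + 1)).-1.
have nE : L * (2 * L + 1) = n.+1 by rewrite prednK //; lia.
(* Index [n] is the last position of round [2 * L]. *)
have nE' : n = 2 * L * L + L.-1 by lia.
have ndiv : n %/ L = 2 * L by rewrite nE' divnMDl // divn_small; lia.
have nmod : n %% L = L.-1 by rewrite nE' modnMDl modn_small; lia.
exists (mkseq w n.+1); split; first by rewrite size_mkseq nE.
- apply: cyclic_mkseq => [t lt|].
    apply: vstep_extend => // b.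
    case: (nextP t) => [[-> ->]|[e -> ->]]; first exact: clock_step.
    rewrite e; apply: clock_next_round.
    have := leq_div2r L lt; rewrite e ndiv; lia.
  apply: vstep_extend => [|b]; last by rewrite ndiv nmod div0n mod0n clock_wrap.
  have := vstepv n; have <- : n.+1 %% L = 0 %% L; last by [].
  by rewrite -nE modnMr mod0n.
- apply: non_dominating_mkseq => i j /andP[ij jn]; apply/negP => le.
  (* If the position increases, [s] itself prevents domination; otherwise [j] lies in a later round
     and a clock decides. *)
  have [lt|ge] := ltnP (i %% L) (j %% L).
    move/pairwiseP: nds => /(_ v0) /(_ (i %% L) (j %% L)).
    by rewrite !inE sL => /(_ (modL i) (modL j) lt); rewrite (vle_extendl le).
  have ds : i %/ L < j %/ L <= 2 * L.
    rewrite -ndiv (leq_div2r L) // andbT ltnNge; apply/negP => h.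
    have := leq_mul h (leqnn L); have := divn_eq i L; have := divn_eq j L; lia.
  have := clock_decr ds ge.
  by rewrite ltnNge (vle_extendr (~~ odd (i %/ L)) le).
Qed.

Theorem theorem1 (d : nat) (hd : d >= 1) :
  Lcirc (d + 2) >= Lcirc d * (2 * Lcirc d + 1).
Proof. exact: (LcircP _).2 _ (ndc_length_extend (LcircP _).1). Qed.
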